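(* Suppose that $\delta>0$ and hence $\beta>0$. Then \[ \sigma(\mathcal A)\subset\{\lambda\in\mathbb C\mid\mathrm{Re}\,\lambda<0,\ |\mathrm{Re}\,\lambda|\notin I_0,\ |\mathrm{Im}\,\lambda|\le h_0(|\mathrm{Re}\,\lambda|)\}, \] where $I_0$ is the (possibly empty) interval centred at $\frac\beta2$ given by \[ I_0:=\begin{cases}\emptyset&\text{if }\beta\delta\le4,\\ \Big(\frac\beta2\Big(1-\sqrt{1-\frac4{\beta\delta}}\Big),\ \frac\beta2\Big(1+\sqrt{1-\frac4{\beta\delta}}\Big)\Big)&\text{if }\beta\delta>4,\end{cases} \] and \[ h_0(t):=\begin{cases}\sqrt{\frac\beta\delta\,\frac t{\beta-t}-t^2},&0\le t<\beta,\ t\notin I_0,\\ \infty,&\beta\le t<\infty;\end{cases} \] in particular, if $\beta\delta>4$, then $\mathcal A$ has a spectral free strip around $\mathrm{Re}\,\lambda=-\frac\beta2$: \[ \sigma(\mathcal A)\cap\{\lambda\in\mathbb C\mid|\mathrm{Re}\,\lambda|\in I_0\}=\emptyset. \] If $\gamma<\infty$ and there is a $\lambda_0\in\rho(\mathcal A)$ with $\mathrm{Re}\,\lambda_0<-\gamma$, then $\sigma(\mathcal A)\cap\{\lambda\in\mathbb C\mid\mathrm{Re}\,\lambda<-\gamma\}=\emptyset$.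
   Context: $H$ is a (complex) Hilbert space with inner product $\langle\cdot,\cdot\rangle$ and norm $\|\cdot\|$. $A_0:\mathcal D(A_0)\subset H\to H$ is a self-adjoint, uniformly positive linear operator with $0\in\rho(A_0)$. $H_{1/2}:=\mathcal D(A_0^{1/2})$ with norm $\|z\|_{H_{1/2}}=\|A_0^{1/2}z\|$ and inner product $\langle x,y\rangle_{H_{1/2}}=\langle A_0^{1/2}x,A_0^{1/2}y\rangle$; $H_{-1/2}$ is the dual of $H_{1/2}$ with respect to the pivot space $H$, i.e. the completion of $H$ with respect to $\|A_0^{-1/2}z\|$; $\langle\cdot,\cdot\rangle_{H_{-1/2}\times H_{1/2}}$ is the duality pairing, with $\langle z',z\rangle_{H_{-1/2}\times H_{1/2}}=\langle z',z\rangle$ for $z'\in H$, $z\in H_{1/2}$. $H_1:=\mathcal D(A_0)$. $A_0$ extends to a bounded operator $H_{1/2}\to H_{-1/2}$, again denoted $A_0$. $D:H_{1/2}\to H_{-1/2}$ is a bounded linear operator such that $\mathrm{Re}\,\langle Dz,z\rangle_{H_{-1/2}\times H_{1/2}}\ge 0$ for all $z\in H_{1/2}$, and $D$ maps $H_1$ into $H$. The operator $\mathcal A$ in $H_{1/2}\times H$ is $\mathcal A=\begin{bmatrix}0&I\\-A_0&-D\end{bmatrix}$ with $\mathcal D(\mathcal A)=\{(z,w)^\top\in H_{1/2}\times H_{1/2}\mid A_0z+Dw\in H\}$. Constants (with $z$ ranging over $H_{1/2}\setminus\{0\}$): \[ \beta=\inf_z\frac{\mathrm{Re}\,\langle Dz,z\rangle_{H_{-1/2}\times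 H_{1/2}}}{\|z\|^2},\quad \gamma=\sup_z\frac{\mathrm{Re}\,\langle Dz,z\rangle_{H_{-1/2}\times H_{1/2}}}{\|z\|^2}\in[0,\infty],\quad \delta=\inf_z\frac{\mathrm{Re}\,\langle Dz,z\rangle_{H_{-1/2}\times H_{1/2}}}{\|z\|_{H_{1/2}}^2}. \] *)

(* Defs.v *)
From HB Require Import structures.
From mathcomp Require Import all_boot all_order all_algebra.
From mathcomp Require Import complex.
From mathcomp Require Import all_classical all_reals all_analysis.
From mathcomp Require Import sesquilinear.

Set Implicit Arguments.
Unset Strict Implicit.
Unset Printing Implicit Defensive.

Import Order.TTheory GRing.Theory Num.Theory.
Import numFieldNormedType.Exports.

Local Open Scope classical_set_scope.
Local Open Scope complex_scope.
Local Open Scope ring_scope.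

(* The norm of a normed space over R[i] takes its values in R[i]; this is the
   same norm, valued in R. *)
Definition rnorm (R : realType) (V : normedModType R[i]) (x : V) : R :=
  complex.Re `|x|.

(* Operators that are only partially defined: the value of [pfun] outside
   [pdom] is irrelevant. *)
Record partial_op (U V : Type) := PartialOp {
  pdom : set U;
  pfun :> U -> V
}.

Record linop (K : pzRingType) (U V : lmodType K) := LinOp {
  linop_op :> partial_op U V;
  linop_dom_closed : submod_closed [pred x | x \in pdom linop_op];
  linop_linear : forall (a : K) (x y : U), pdom linop_op x -> pdom linop_op y ->
    linop_op (a *: x + y) = a *: linop_op x + linop_op y
}.

Definition bounded_op (R : realType) (U V : Type) (nU : U -> R) (nV : V -> R)
    (T : U -> V) : Prop :=
  exists C : R, forall x, nV (T x) <= C * nU x.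

Section spectrum.
Context (R : realType) (X : lmodType R[i]) (nX : X -> R) (T : partial_op X X).

(* T - lambda maps the domain of T bijectively onto X and its inverse G is
   bounded. *)
Definition resolvent_set : set R[i] := [set l | exists G : {linear X -> X},
  [/\ bounded_op nX nX G,
      forall y, pdom T (G y) /\ T (G y) - l *: G y = y &
      forall x, pdom T x -> G (T x - l *: x) = x]].

Definition spectrum : set R[i] := ~` resolvent_set.

End spectrum.

Section operators_in_H.
Context (R : realType) (H : completeNormedModType R[i]).
Context (dot : {dot H for (@Num.conj R[i])}).

Definition op_graph (A : partial_op H H) : set (H * H) :=
  [set p | pdom A p.1 /\ A p.1 = p.2].

Definition adjoint_graph (A : partial_op H H) : set (H * H) :=
  [set p | forall x, pdom A x -> dot (A x) p.1 = dot x p.2].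

Definition self_adjoint (A : partial_op H H) : Prop :=
  dense (pdom A) /\ adjoint_graph A = op_graph A.

Definition nonneg_op (A : partial_op H H) : Prop :=
  forall x, pdom A x -> 0 <= dot (A x) x.

Definition uniformly_positive (A : partial_op H H) : Prop :=
  exists2 c : R, 0 < c &
    forall x, pdom A x -> (c * rnorm x ^+ 2)%:C <= dot (A x) x.

(* S is the nonnegative self-adjoint square root of A. *)
Definition is_sqrt_op (S A : partial_op H H) : Prop :=
  [/\ self_adjoint S, nonneg_op S,
      pdom A = [set x | pdom S x /\ pdom S (S x)] &
      forall x, pdom A x -> A x = S (S x)].

End operators_in_H.

(* The domain of an operator as a vector space.  With S = A_0^{1/2} this is
   H_{1/2}. *)
Section domain_space.
Context (K : nzRingType) (U V : lmodType K) (S : linop U V).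

Definition dom_pred : {pred U} := [pred x | x \in pdom S].

HB.instance Definition _ :=
  GRing.isSubmodClosed.Build K U dom_pred (linop_dom_closed S).

Record dom_space := DomSpace {
  dom_val :> U;
  dom_valP : dom_val \in dom_pred
}.

HB.instance Definition _ := [isSub for dom_val].
HB.instance Definition _ := [Choice of dom_space by <:].
HB.instance Definition _ := [SubChoice_isSubLmodule of dom_space by <:].

End domain_space.

(* The antidual: bounded conjugate-linear functionals.  As the inner product is
   conjugate-linear in its second argument, h |-> <h, .> is a linear embedding
   of the pivot space H into the antidual of H_{1/2}. *)
Section antidual.
Context (R : realType) (V : lmodType R[i]) (nV : V -> R).

Definition antidual_pred : {pred V -> R[i]^o} := [pred f : V -> R[i]^o | `[<
  GRing.linear_for (@Num.conj R[i] \; *%R) f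
  /\ bounded_op nV (@rnorm R R[i]^o) f >]].

Lemma antidual_pred_closed : submod_closed antidual_pred.
Proof.
have reD (x y : R[i]) : complex.Re (x + y) = complex.Re x + complex.Re y.
  by case: x y => [? ?] [? ?].
have re_le (x y : R[i]) : x <= y -> complex.Re x <= complex.Re y.
  by case: x y => [a b] [c d]; rewrite lecE => /andP[].
split.
  apply/asboolP; split.
    by move=> a u v; rewrite /= mulr0 addr0.
  by exists 0 => x; rewrite /rnorm normr0 mul0r.
move=> a f g /asboolP[fl [C fC]] /asboolP[gl [D gD]]; apply/asboolP; split.
  move=> b u v; rewrite !fctE fl gl /= !scalerDr.
  rewrite addrACA; congr (_ + _); rewrite mulrDr; congr (_ + _).
  exact: mulrCA.
exists (complex.Re `|a| * C + D) => x; rewrite mulrDl.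
apply: (@le_trans _ _ (complex.Re (`|a *: f x| + `|g x|))).
  exact/re_le/ler_normD.
rewrite reD lerD ?gD// normrZ -mulrA.
have -> : complex.Re (`|a| * `|f x|) = complex.Re `|a| * rnorm (f x).
  by rewrite /rnorm !normc_def /= mul0r subr0.
apply: ler_wpM2l (fC x).
by apply: (re_le 0); exact: normr_ge0.
Qed.

HB.instance Definition _ :=
  GRing.isSubmodClosed.Build R[i] (V -> R[i]^o) antidual_pred
    antidual_pred_closed.

Record antidual := Antidual {
  pairing :> V -> R[i]^o;
  antidualP : pairing \in antidual_pred
}.

HB.instance Definition _ := [isSub for pairing].
HB.instance Definition _ := [Choice of antidual by <:].
HB.instance Definition _ := [SubChoice_isSubLmodule of antidual by <:].

Definition antidual_norm (f : antidual) : R :=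
  sup [set rnorm (pairing f v) | v in [set v | nV v <= 1]].

End antidual.

Section second_order.
Context (R : realType) (H : completeNormedModType R[i]).
Context (dot : {dot H for (@Num.conj R[i])}).
(* S stands for A_0^{1/2} *)
Context (S : linop H H).

Definition Hhalf := dom_space S.
HB.instance Definition _ := GRing.Lmodule.on Hhalf.
HB.instance Definition _ := SubChoice.on Hhalf.

Definition nhalf (z : Hhalf) : R := rnorm (S (val z)).

Definition Hmhalf := antidual nhalf.
HB.instance Definition _ := GRing.Lmodule.on Hmhalf.

Definition nmhalf (f : Hmhalf) : R := antidual_norm f.

(* The element f of H_{-1/2} is the element h of the pivot space H. *)
Definition represents (h : H) (f : Hmhalf) : Prop :=
  forall z : Hhalf, pairing f z = dot h (val z).

Definition in_pivot : set Hmhalf := [set f | exists h, represents h f].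

(* The element of H representing f, for f in H. *)
Definition pivot_rep (f : Hmhalf) : H := xget 0 [set h | represents h f].

(* Ae is the bounded extension of A to an operator from H_{1/2} to H_{-1/2}. *)
Definition is_extension (A : linop H H) (Ae : Hhalf -> Hmhalf) : Prop :=
  bounded_op nhalf nmhalf Ae /\
  forall z : Hhalf, pdom A (val z) -> represents (A (val z)) (Ae z).

Definition energy_space := (Hhalf * H)%type.
HB.instance Definition _ := GRing.Lmodule.on energy_space.

Definition nenergy (x : energy_space) : R :=
  Num.sqrt (nhalf x.1 ^+ 2 + rnorm x.2 ^+ 2).

(* [insubd 0 w] is w seen as an element of H_{1/2}, for w in H_{1/2}. *)
Definition block_op (Ae D : Hhalf -> Hmhalf) :
    partial_op energy_space energy_space :=
  let toHhalf (w : H) : Hhalf := insubd 0 w in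
  PartialOp
    [set x : energy_space | pdom S x.2 /\ in_pivot (Ae x.1 + D (toHhalf x.2))]
    (fun x => (toHhalf x.2, - pivot_rep (Ae x.1 + D (toHhalf x.2)))).

Section constants.
Variable D : Hhalf -> Hmhalf.

Definition re_form (z : Hhalf) : R := complex.Re (pairing (D z) z).

(* beta and delta are infima of sets that are bounded below by 0, by
   accretivity of D, and nonempty unless H = 0. *)
Definition beta : R :=
  inf [set re_form z / rnorm (val z) ^+ 2 | z in [set z | z != 0]].

Definition gamma : \bar R :=
  ereal_sup [set (re_form z / rnorm (val z) ^+ 2)%:E | z in [set z | z != 0]].

Definition delta : R :=
  inf [set re_form z / nhalf z ^+ 2 | z in [set z | z != 0]].

End constants.

End second_order.

Definition I0 (R : realType) (beta delta : R) : set R :=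
  if beta * delta <= 4 then set0
  else `]beta / 2 * (1 - Num.sqrt (1 - 4 / (beta * delta))),
         beta / 2 * (1 + Num.sqrt (1 - 4 / (beta * delta)))[%classic.

(* Only meaningful for 0 <= t outside I0 beta delta. *)
Definition h0 (R : realType) (beta delta t : R) : \bar R :=
  if t < beta
  then (Num.sqrt (beta / delta * (t / (beta - t)) - t ^+ 2))%:E
  else +oo%E.

(* Main.v *)
Require Import Defs.
From HB Require Import structures.
From mathcomp Require Import all_boot all_order all_algebra.
From mathcomp Require Import complex.
From mathcomp Require Import all_classical all_reals all_analysis.
From mathcomp Require Import sesquilinear.
From mathcomp Require Import ring lra.

Set Implicit Arguments.
Unset Strict Implicit.
Unset Printing Implicit Defensive.

Import Order.TTheory GRing.Theory Num.Theory.
Import numFieldNormedType.Exports.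

Local Open Scope classical_set_scope.
Local Open Scope complex_scope.
Local Open Scope ring_scope.

(** For [l] put [L(l) = l^2 + l D + A_0], an operator from [H_{1/2}] to
    [H_{-1/2}].  Eliminating the second component from
    [(A - l) (z, w) = (f, g)] gives [w = l z + f] and
    [L(l) z = - g - l f - D f], so [l] is in the resolvent set of the block
    operator as soon as [L(l)] is an isomorphism ([block_solutionP],
    [coercive_resolvent]).  By the Lax-Milgram theorem ([lax_milgram]) this
    holds whenever, for some complex number [mu] and some [c > 0],
    [Re (mu <L(l) z, z>) >= c |z|_{1/2}^2] for all [z].

    The multiplier is [conj l], up to sign.  With [N = |l|^2],
    [p = |z|^2], [q = |z|_{1/2}^2] and [r = Re <D z, z>],
      [Re (conj l <L(l) z, z>) = Re l q + N r + N Re l p]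
    ([Re_conj_pencil]), and three regimes are covered.
    - If [Re l >= 0] and [l <> 0], the right-hand side is at least
      [N r >= N delta q] ([rho_right]); at [l = 0] the form is [q] itself.
    - If [t = - Re l] lies in [(0, beta)], write [r] as the convex combination
      of [r >= beta p] and [r >= delta q] with weights [t / beta] and
      [1 - t / beta].  The terms in [p] cancel and what remains is
      [(N (1 - t / beta) delta - t) q]; its coefficient is positive exactly
      when [N > (beta / delta) t / (beta - t)] ([rho_outside_curve]).  This says
      that [l] is outside the curve [h_0], and it holds for every imaginary part
      when [t] is in [I_0], because [I_0] is the set where
      [beta / delta < t (beta - t)] ([strip_curve]).
    - If [- Re l > gamma], then [r <= gamma p] makes the opposite of the
      right-hand side at least [- Re l q] ([rho_left]).

    The Lax-Milgram theorem is derived from the minimisation of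
    [a(x, x) - 2 Re f(x)] for a coercive Hermitian form [a]
    ([hermitian_representation]).  On [H_{1/2}] it is applied through the
    isometry [A_0^{-1/2}] from [H] onto [H_{1/2}] ([S_half_bijective]); that
    the form of the extended [A_0] is the inner product of [H_{1/2}] follows
    from the density of the domain of [A_0] ([A0e_pairing]). *)

(** * Real parts and moduli of complex numbers *)

Section complex_numbers.
Variable R : rcfType.
Implicit Types x y : R[i].

Lemma ReD x y : complex.Re (x + y) = complex.Re x + complex.Re y.
Proof. by case: x y => [? ?] [? ?]. Qed.

Lemma ImD x y : complex.Im (x + y) = complex.Im x + complex.Im y.
Proof. by case: x y => [? ?] [? ?]. Qed.

Lemma ReN x : complex.Re (- x) = - complex.Re x.
Proof. by case: x. Qed.

Lemma ReB x y : complex.Re (x - y) = complex.Re x - complex.Re y.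
Proof. by rewrite ReD ReN. Qed.

Lemma ReM x y : complex.Re (x * y) =
  complex.Re x * complex.Re y - complex.Im x * complex.Im y.
Proof. by case: x y => [? ?] [? ?]. Qed.

Lemma ImM x y : complex.Im (x * y) =
  complex.Re x * complex.Im y + complex.Im x * complex.Re y.
Proof. by case: x y => [? ?] [? ?]. Qed.

Lemma Re_conj x : complex.Re (Num.conj x) = complex.Re x.
Proof. by case: x. Qed.

Lemma Im_conj x : complex.Im (Num.conj x) = - complex.Im x.
Proof. by case: x. Qed.

Lemma ReZ (r : R) x : complex.Re (r%:C * x) = r * complex.Re x.
Proof. by rewrite ReM /= mul0r subr0. Qed.

Lemma conj_real (r : R) : Num.conj (r%:C) = r%:C.
Proof. exact: conjc_real. Qed.

Lemma complex_ext x y : complex.Re x = complex.Re y ->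
  complex.Im x = complex.Im y -> x = y.
Proof. by case: x y => [? ?] [? ?] /= -> ->. Qed.

Lemma Re_le x y : x <= y -> complex.Re x <= complex.Re y.
Proof. by rewrite lecE => /andP[]. Qed.

End complex_numbers.

(** * The real-valued norm *)

Section real_valued_norm.
Variables (R : realType) (V : normedModType R[i]).
Implicit Types x y : V.

Lemma normE x : `|x| = (rnorm x)%:C.
Proof. by rewrite /rnorm RRe_real. Qed.

Lemma rnorm_ge0 x : 0 <= rnorm x.
Proof. by rewrite -lecR -normE normr_ge0. Qed.

Lemma rnorm0 : rnorm (0 : V) = 0.
Proof. by rewrite /rnorm normr0. Qed.

Lemma rnorm_eq0 x : rnorm x = 0 -> x = 0.
Proof. by move=> x0; apply/eqP; rewrite -normr_eq0 normE x0. Qed.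

Lemma rnormN x : rnorm (- x) = rnorm x.
Proof. by rewrite /rnorm normrN. Qed.

Lemma ler_rnormD x y : rnorm (x + y) <= rnorm x + rnorm y.
Proof. by rewrite /rnorm -ReD; apply: Re_le; exact: ler_normD. Qed.

Lemma rnormZ (a : R[i]) x : rnorm (a *: x) = rnorm (a : R[i]^o) * rnorm x.
Proof. by rewrite {1}/rnorm normrZ normE ReZ. Qed.

End real_valued_norm.

(** Completeness of the space, read through the real-valued norm. *)
Lemma cauchy_rnorm_cvg (R : realType) (W : completeNormedModType R[i])
    (u : nat -> W) :
  (forall e : R, 0 < e ->
     exists N : nat, forall m n, (N <= m)%N -> (N <= n)%N ->
     rnorm (u m - u n) < e) ->
  exists l, forall e : R, 0 < e ->
    exists N : nat, forall n, (N <= n)%N -> rnorm (u n - l) < e.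
Proof.
move=> cu.
have : cvgn u.
  apply/cauchy_cvgP/cauchy_ballP => e e0; near_simpl.
  have e0' : 0 < complex.Re e by move: e0; rewrite ltcE => /andP[].
  have eE : e = (complex.Re e)%:C by rewrite RRe_real// gtr0_real.
  have [N uN] := cu _ e0'.
  exists ([set n | N <= n], [set n | N <= n])%N; first by split; exists N.
  move=> [m n] [/= Nm Nn]; rewrite -ball_normE /= eE.
  by have := uN m n Nm Nn; rewrite -ltcR -normE.
move=> /cvg_ex[l /cvgrPdist_lt ul]; exists l => e e0.
have /ul[N _ uN] : 0 < e%:C by rewrite ltcR.
exists N => n Nn; rewrite -ltcR -normE distrC; exact: uN.
Qed.

Local Notation cabs z := (rnorm (z : (_[i])^o)).

Section modulus.
Variable R : realType.
Implicit Types z w : R[i].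

Lemma cabsM z w : cabs (z * w) = cabs z * cabs w.
Proof. by rewrite -[z * w]/(z *: (w : R[i]^o)) rnormZ. Qed.

Lemma cabs_sqr z : cabs z ^+ 2 = complex.Re z ^+ 2 + complex.Im z ^+ 2.
Proof. by rewrite /rnorm normc_def /= sqr_sqrtr// addr_ge0// sqr_ge0. Qed.

Lemma cabs_conj z : cabs (Num.conj z) = cabs z.
Proof. by rewrite /rnorm -[Num.conj z]/(conjc z) normcJ. Qed.

Lemma normRe_cabs z : `|complex.Re z| <= cabs z.
Proof. by rewrite -lecR /rnorm RRe_real// normc_ge_Re. Qed.

Lemma Re_cabs z : complex.Re z <= cabs z.
Proof. exact: le_trans (ler_norm _) (normRe_cabs z). Qed.

Lemma cabs_real (r : R) : 0 <= r -> cabs r%:C = r.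
Proof. by move=> r0; rewrite /rnorm ger0_norm // ler0c. Qed.

End modulus.

(** * Coercive forms on a Hilbert space *)

Local Notation conj_scale := (@Num.conj _ \; *%R).

Section inner_product.
Variables (R : realType) (H : completeNormedModType R[i]).
Variables (dot : {dot H for (@Num.conj R[i])}).
Hypothesis norm_dot : forall x : H, `|x| ^+ 2 = dot x x.
Implicit Types x y u v : H.

Lemma dotC x y : dot x y = Num.conj (dot y x).
Proof. by rewrite hermC expr0 mul1r. Qed.

Lemma dotBl x y u : dot (x - y) u = dot x u - dot y u.
Proof. exact: linearBl. Qed.

Lemma dotBr u x y : dot u (x - y) = dot u x - dot u y.
Proof. exact: linearBr. Qed.

Lemma dotPl a x y u : dot (a *: x + y) u = a * dot x u + dot y u.
Proof. by rewrite linearDl linearZl_LR. Qed.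

Lemma dotPr a u x y : dot u (a *: x + y) = Num.conj a * dot u x + dot u y.
Proof. by rewrite linearDr linearZr_LR. Qed.

Lemma rnorm_sqr x : rnorm x ^+ 2 = complex.Re (dot x x).
Proof. by rewrite -norm_dot normE -rmorphXn. Qed.

Lemma cauchy_schwarz_Re x y : complex.Re (dot x y) <= rnorm x * rnorm y.
Proof.
have [x0|x0] := eqVneq (rnorm x) 0.
  by rewrite (rnorm_eq0 x0) linear0l rnorm0 mul0r.
have [y0|y0] := eqVneq (rnorm y) 0.
  by rewrite (rnorm_eq0 y0) linear0r rnorm0 mulr0.
have xp : 0 < rnorm x by rewrite lt_def x0 rnorm_ge0.
have yp : 0 < rnorm y by rewrite lt_def y0 rnorm_ge0.
(* the square of |y| x - |x| y is nonnegative *)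
have := sqr_ge0 (rnorm ((rnorm y)%:C *: x - (rnorm x)%:C *: y)).
rewrite rnorm_sqr linearBl !linearBr !linearZl_LR !linearZr_LR /= !conj_real.
rewrite !(ReB, ReZ) -!rnorm_sqr (dotC y x) Re_conj => sq.
rewrite -(ler_pM2l (mulr_gt0 xp yp)); lra.
Qed.

(** Multiplying [x] by the conjugate of [dot x y] makes the inner product real,
    which reduces the estimate to that of the real part. *)
Lemma cauchy_schwarz x y : cabs (dot x y) <= rnorm x * rnorm y.
Proof.
set z := dot x y.
have [z0|z0] := eqVneq (cabs z) 0.
  by rewrite z0 mulr_ge0// rnorm_ge0.
have zp : 0 < cabs z by rewrite lt_def z0 rnorm_ge0.
rewrite -(ler_pM2l zp) mulrA -[in leRHS](cabs_conj z) -(rnormZ _ x).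
apply: le_trans (cauchy_schwarz_Re _ _).
by rewrite linearZl_LR /= -/z ReM Re_conj Im_conj -expr2 cabs_sqr; lra.
Qed.

Lemma quadratic_functional_expand
    (a : {hermitian H for false & (@Num.conj R[i])})
    (f : {linear H -> R[i] | conj_scale}) (x h : H) (t : R) :
  let J x := complex.Re (a x x) - 2 * complex.Re (f x) in
  J (x + t%:C *: h) =
  J x + 2 * t * complex.Re (a x h - f h) + t ^+ 2 * complex.Re (a h h).
Proof.
rewrite /= (linearDl a) !(linearDr a) !(linearZl_LR a) !(linearZr_LR a) /=.
rewrite (linearD f) (linearZ_LR f) /= !conj_real.
rewrite !(ReD, ReZ, ReN) (hermC a h x) expr0 mul1r Re_conj; ring.
Qed.

(** The representing vector minimises [J x = a(x, x) - 2 Re f(x)].  By the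
    parallelogram law and coercivity, a minimising sequence is Cauchy; the first
    variation of [J] at its limit vanishes in every direction. *)
Lemma hermitian_representation (a : {hermitian H for false & (@Num.conj R[i])})
    (f : {linear H -> R[i] | conj_scale}) (c C F : R) :
  0 < c -> (forall x, c * rnorm x ^+ 2 <= complex.Re (a x x)) ->
  (forall x y, cabs (a x y) <= C * (rnorm x * rnorm y)) ->
  (forall x, cabs (f x) <= F * rnorm x) ->
  exists u, forall x, a u x = f x.
Proof.
move=> c0 a_coer a_bdd f_bdd.
pose J x := complex.Re (a x x) - 2 * complex.Re (f x).
have J_expand x h t : J (x + t%:C *: h) =
    J x + 2 * t * complex.Re (a x h - f h) + t ^+ 2 * complex.Re (a h h).
  exact: quadratic_functional_expand.
have J_lb x : - (F ^+ 2 / c) <= J x.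
  rewrite -(ler_pM2l c0) mulrN mulrCA divff ?gt_eqF// mulr1 /J.
  have /(ler_wpM2l (ltW c0)) := le_trans (Re_cabs (f x)) (f_bdd x).
  have /(ler_wpM2l (ltW c0)) := a_coer x.
  by have := sqr_ge0 (c * rnorm x - F); lra.
pose m := inf (range J).
have m_le x : m <= J x.
  by apply: ge_inf; [exists (- (F ^+ 2 / c)) => _ [y _ <-]|exists x].
have m_adh e : 0 < e -> exists x, J x < m + e.
  move=> e0; have [|_ [x _ <-] Jx] := @inf_adherent _ (range J) _ e0.
    by split; [exists (J 0), 0|exists (- (F ^+ 2 / c)) => _ [y _ <-]].
  by exists x.
have /choice[u uJ] : forall n : nat, exists x, J x < m + n.+1%:R^-1.
  by move=> n; apply: m_adh; rewrite invr_gt0.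
have uJN N n : (N <= n)%N -> J (u n) < m + N.+1%:R^-1.
  move=> Nn; apply: lt_le_trans (uJ n) _.
  by rewrite lerD2l lef_pV2 ?posrE// ler_nat ltnS.
have invN e : 0 < e -> exists N : nat, N.+1%:R^-1 < e :> R.
  by move=> /ltr_add_invr[N]; rewrite add0r; exists N.
have [l ul] : exists l, forall e : R, 0 < e ->
    exists N : nat, forall n, (N <= n)%N -> rnorm (u n - l) < e.
  apply: cauchy_rnorm_cvg => e e0.
  have [N Ne] : exists N : nat, N.+1%:R^-1 < c * e ^+ 2 / 4 :> R.
    by apply: invN; rewrite divr_gt0// mulr_gt0// exprn_gt0.
  exists N => i j Ni Nj.
  (* parallelogram law: compare [J] at [u i], [u j] and their midpoint *)
  have Jh := J_expand (u j) (u i - u j) 2^-1.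
  have := J_expand (u j) (u i - u j) 1.
  rewrite scale1r addrC subrK => J1.
  have := m_le (u j + (2^-1)%:C *: (u i - u j)); rewrite {}Jh => Jh.
  have uj := uJN _ _ Nj; have ui := uJN _ _ Ni.
  have ac := a_coer (u i - u j).
  have : c * rnorm (u i - u j) ^+ 2 < c * e ^+ 2.
    move: J1 Jh uj ui ac Ne; move: (complex.Re _) (complex.Re _) (J _) (J _).
    by move: (rnorm _) N.+1%:R^-1 => r d p q Ji Jj; lra.
  rewrite ltr_pM2l// ltr_sqr// ?nnegrE ?rnorm_ge0//; exact: ltW.
have variation h : complex.Re (a l h - f h) = 0.
  set e := complex.Re _; set q := complex.Re (a h h).
  have q0 : 0 <= q.
    by apply: le_trans (a_coer h); rewrite mulr_ge0 ?sqr_ge0// ltW.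
  (* minimality of [l], read off along the sequence [u], so that the
     continuity of [J] is only needed for the term that is linear in [t] *)
  have te t : 0 <= 2 * t * e + t ^+ 2 * q.
    apply/ler_addgt0Pr => d d0.
    have d2 : 0 < d / 2 by rewrite divr_gt0.
    pose K := `|2 * t| * (`|C| * rnorm h) + 1.
    have K0 : 0 < K by rewrite ltr_wpDl// !mulr_ge0// rnorm_ge0.
    have [N1 uN1] := ul _ (divr_gt0 d2 K0).
    have [N2 Nd] := invN _ d2.
    pose n := maxn N1 N2.
    have := uN1 n (leq_maxl _ _); rewrite ltr_pdivlMr// => un.
    have := uJN _ n (leq_maxr N1 N2) => Jn.
    have := m_le (u n + t%:C *: h); rewrite J_expand -/q.
    have -> : a (u n) h - f h = (a l h - f h) + a (u n - l) h.
      by rewrite linearBl; ring.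
    rewrite ReD -/e mulrDr.
    suff : 2 * t * complex.Re (a (u n - l) h) <= rnorm (u n - l) * K.
      move: Jn Nd un; move: (complex.Re _) (J _) N2.+1%:R^-1 (_ * K).
      by move=> r Jn p s; lra.
    apply: le_trans (ler_norm _) _; rewrite normrM.
    apply: (@le_trans _ _ (`|2 * t| * (`|C| * (rnorm (u n - l) * rnorm h)))).
      apply: ler_wpM2l => //; apply: le_trans (normRe_cabs _) _.
      apply: le_trans (a_bdd _ _) _.
      by rewrite ler_wpM2r ?ler_norm// mulr_ge0// rnorm_ge0.
    have := rnorm_ge0 (u n - l); rewrite /K; lra.
  have q1 : 0 < q + 1 by lra.
  (* the minimum of the parabola is at [- e / q], but [q] may vanish *)
  have := te (- e / (q + 1)).
  have -> : 2 * (- e / (q + 1)) * e + (- e / (q + 1)) ^+ 2 * q =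
      - (e ^+ 2 * (q + 2)) / (q + 1) ^+ 2.
    by field; rewrite gt_eqF.
  rewrite mulNr oppr_ge0 ler_pdivrMr ?exprn_gt0// mul0r => e2.
  apply/eqP; rewrite -sqrf_eq0 eq_le sqr_ge0 andbT.
  by move: e2; rewrite pmulr_lle0//; lra.
exists l => x; apply/eqP; rewrite -subr_eq0; apply/eqP.
apply: complex_ext; first exact: variation.
(* [f] is conjugate-linear: its imaginary part is the real part at [i x] *)
have := variation ('i *: x).
by rewrite linearZr_LR linearZ_LR /= -mulrBr ReM Re_conj Im_conj /=; lra.
Qed.

Lemma riesz (f : {linear H -> R[i] | conj_scale}) (F : R) :
  (forall x, cabs (f x) <= F * rnorm x) -> exists u, forall x, dot u x = f x.
Proof.
apply: (@hermitian_representation dot f 1 1); first exact: ltr01.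
  by move=> x; rewrite mul1r rnorm_sqr.
by move=> x y; rewrite mul1r cauchy_schwarz.
Qed.

(** If [B] is the operator with [b x y = dot (B x) y], then the Hermitian form
    [dot (B^* u) (B^* y)] is coercive, and the vector [u] which represents [f]
    for that form gives the solution [B^* u], since
    [dot (B^* u) (B^* y) = b (B^* u) y].  The complex factor [mu] allows
    the values [b x x] on unit vectors to lie in any closed half-plane that
    does not contain 0. *)
Lemma lax_milgram
    (b : {bilinear H -> H -> R[i] | *%R & conj_scale})
    (f : {linear H -> R[i] | conj_scale})
    (mu : R[i]) (c C F : R) :
  0 < c -> (forall x, c * rnorm x ^+ 2 <= complex.Re (mu * b x x)) ->
  0 <= C -> (forall x y, cabs (b x y) <= C * (rnorm x * rnorm y)) ->
  (forall x, cabs (f x) <= F * rnorm x) ->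
  exists u, forall x, b u x = f x.
Proof.
move=> c0 b_coer C0 b_bdd f_bdd.
have /choice[Bs BsE] : forall u, exists v, forall x, dot v x = Num.conj (b x u).
  move=> u.
  pose g x := Num.conj (b x u).
  have gl : GRing.linear_for conj_scale g.
    by move=> k x y; rewrite /g linearDl linearZl_LR /= rmorphD rmorphM.
  pose g' := HB.pack_for {linear H -> R[i] | conj_scale} g
    (GRing.isLinear.Build _ _ _ _ g gl).
  apply: (@riesz g' (C * rnorm u)) => x.
  by rewrite /= /g cabs_conj -mulrA [rnorm u * _]mulrC.
pose a u y := dot (Bs u) (Bs y).
have aE u y : a u y = b (Bs u) y.
  by rewrite /a dotC BsE conjCK.
have al y : GRing.linear_for *%R (a^~ y).
  move=> k u v; rewrite /a !BsE linearDr linearZr_LR /= rmorphD rmorphM.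
  by rewrite /= conjCK.
have ar x : GRing.linear_for conj_scale (a x).
  by move=> k u v; rewrite !aE linearDr linearZr_LR.
have ah x y : a x y = (-1) ^+ false * Num.conj (a y x).
  by rewrite expr0 mul1r -dotC.
pose a' := HB.pack_for {hermitian H for false & (@Num.conj R[i])} a
  (bilinear_isBilinear.Build _ _ _ _ _ _ a (al, ar))
  (isHermitianSesquilinear.Build _ _ _ _ a ah).
have Bs_le u : rnorm (Bs u) <= C * rnorm u.
  have [->|n0] := eqVneq (rnorm (Bs u)) 0; first by rewrite mulr_ge0 ?rnorm_ge0.
  have np : 0 < rnorm (Bs u) by rewrite lt_def n0 rnorm_ge0.
  rewrite -(ler_pM2l np) -expr2 rnorm_sqr BsE Re_conj.
  apply: le_trans (Re_cabs _) _; apply: le_trans (b_bdd _ _) _; lra.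
pose c1 := c / (cabs mu + 1).
have mu1 : 0 < cabs mu + 1 by rewrite ltr_wpDl ?rnorm_ge0.
have c10 : 0 < c1 by rewrite divr_gt0.
have Bs_ge u : c1 * rnorm u <= rnorm (Bs u).
  have [->|n0] := eqVneq (rnorm u) 0; first by rewrite mulr0 rnorm_ge0.
  have np : 0 < rnorm u by rewrite lt_def n0 rnorm_ge0.
  rewrite /c1 mulrAC ler_pdivrMr// -(ler_pM2r np) -mulrA -expr2.
  apply: le_trans (b_coer u) _; apply: le_trans (Re_cabs _) _; rewrite cabsM.
  rewrite -[cabs (b u u)]cabs_conj -BsE [leRHS]mulrAC mulrC.
  apply: ler_pM; rewrite ?rnorm_ge0 ?cauchy_schwarz//; lra.
have [u uf] : exists u, forall x, a' u x = f x.
  apply: (@hermitian_representation a' f (c1 ^+ 2) (C ^+ 2) F) => //.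
  - by rewrite exprn_gt0.
  - move=> x; rewrite /= /a -rnorm_sqr -exprMn ler_sqr ?nnegrE ?rnorm_ge0//.
    by rewrite mulr_ge0 ?rnorm_ge0// ltW.
  - move=> x y; rewrite /= aE; apply: le_trans (b_bdd _ _) _.
    rewrite expr2 -[leRHS]mulrA ler_wpM2l// mulrA ler_wpM2r ?rnorm_ge0//.
by exists (Bs u) => x; rewrite -aE; exact: uf.
Qed.

End inner_product.

(** * The spaces [H_{1/2}] and [H_{-1/2}] *)

Section energy_domain.
Variables (R : realType) (H : completeNormedModType R[i]) (S : linop H H).
Implicit Types (x y z : Hhalf S) (f : Hmhalf S).

Lemma val_half_dom z : pdom S (val z).
Proof. by have := dom_valP z; rewrite inE. Qed.

Lemma val_insubd_half (w : H) : pdom S w -> val (insubd (0 : Hhalf S) w) = w.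
Proof. by move=> Sw; rewrite insubdK// inE. Qed.

Lemma S_half_linear (a : R[i]) x y :
  S (val (a *: x + y)) = a *: S (val x) + S (val y).
Proof. by rewrite -linop_linear//; exact: val_half_dom. Qed.

Lemma S_half0 : S (val (0 : Hhalf S)) = 0.
Proof.
by have := S_half_linear (-1) 0 0; rewrite scaler0 addr0 scaleN1r addNr.
Qed.

Lemma nhalf_ge0 z : 0 <= nhalf z. Proof. exact: rnorm_ge0. Qed.

Lemma nhalfZ (a : R[i]) z : nhalf (a *: z) = cabs a * nhalf z.
Proof.
by rewrite -[a *: z]addr0 /nhalf S_half_linear S_half0 addr0 rnormZ.
Qed.

Lemma pairing_linearl (a : R[i]) f (g : Hmhalf S) z :
  pairing (a *: f + g) z = a * pairing f z + pairing g z.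
Proof. by []. Qed.

Lemma pairing_linearr (a : R[i]) f x y :
  pairing f (a *: x + y) = Num.conj a * pairing f x + pairing f y.
Proof. by have /asboolP[-> _] := antidualP f. Qed.

Lemma pairing0r f : pairing f 0 = 0.
Proof.
have := pairing_linearr (-1) f 0 0.
by rewrite scaler0 addr0 rmorphN rmorph1 mulN1r addNr.
Qed.

(** The supremum defining the antidual norm is finite because [f] is bounded;
    for [nhalf z = 0] that same boundedness forces the pairing to vanish. *)
Lemma pairing_bound f z : cabs (pairing f z) <= nmhalf f * nhalf z.
Proof.
have /asboolP[fl [C fC]] := antidualP f.
have [z0|z0] := eqVneq (nhalf z) 0.
  by rewrite z0 mulr0; apply: le_trans (fC z) _; rewrite z0 mulr0.
have zp : 0 < nhalf z by rewrite lt_def z0 nhalf_ge0.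
rewrite -ler_pdivrMr// mulrC.
set r := (nhalf z)^-1.
have r0 : 0 <= r by rewrite invr_ge0 ltW.
have -> : r * cabs (pairing f z) = cabs (pairing f (r%:C *: z)).
  have -> : pairing f (r%:C *: z) = Num.conj r%:C * pairing f z.
    by rewrite -[_ *: z]addr0 pairing_linearr pairing0r addr0.
  by rewrite cabsM cabs_conj cabs_real.
apply: ub_le_sup; last first.
  by exists (r%:C *: z) => //=; rewrite nhalfZ cabs_real// mulVf.
exists `|C| => _ [v /= v1 <-]; apply: le_trans (fC v) _.
rewrite -[leRHS]mulr1; apply: le_trans (ler_wpM2r (nhalf_ge0 v) (ler_norm C)) _.
exact: ler_wpM2l.
Qed.

Lemma form_bound (L : Hhalf S -> Hmhalf S) :
  bounded_op (@nhalf R H S) (@nmhalf R H S) L ->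
  exists2 C : R, 0 <= C &
    forall x y, cabs (pairing (L x) y) <= C * (nhalf x * nhalf y).
Proof.
move=> [C LC]; exists `|C| => // x y; apply: le_trans (pairing_bound _ _) _.
rewrite mulrA ler_wpM2r ?nhalf_ge0//; apply: le_trans (LC x) _.
by rewrite ler_wpM2r ?nhalf_ge0// ler_norm.
Qed.

Lemma nenergy_ge (u : energy_space S) :
  nhalf u.1 <= nenergy u /\ rnorm u.2 <= nenergy u.
Proof.
split; rewrite -[leLHS]ger0_norm ?nhalf_ge0 ?rnorm_ge0// -sqrtr_sqr;
  rewrite ler_wsqrtr//.
  by rewrite lerDl sqr_ge0.
by rewrite lerDr sqr_ge0.
Qed.

Lemma nenergy_le (u : energy_space S) : nenergy u <= nhalf u.1 + rnorm u.2.
Proof.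
have a0 := nhalf_ge0 u.1; have b0 := rnorm_ge0 u.2.
rewrite -[leRHS]ger0_norm ?addr_ge0// -sqrtr_sqr ler_wsqrtr//.
by have := mulr_ge0 a0 b0; lra.
Qed.

End energy_domain.

(** * The square root of [A_0] as an isometry *)

Section square_root.
Variables (R : realType) (H : completeNormedModType R[i]).
Variables (dot : {dot H for (@Num.conj R[i])}).
Hypothesis norm_dot : forall x : H, `|x| ^+ 2 = dot x x.
Variables (A0 S : linop H H).
Hypothesis A0_resolvent : resolvent_set (@rnorm R H) A0 0.
Hypothesis S_sqrt : is_sqrt_op dot S A0.
Implicit Types x y z v : Hhalf S.

Lemma S_symmetric x y : dot (S (val x)) (val y) = dot (val x) (S (val y)).
Proof.
have [[_ Ssa] _ _ _] := S_sqrt.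
have : op_graph S (val y, S (val y)) by split => //; exact: val_half_dom.
by rewrite -Ssa => /(_ (val x)); apply; exact: val_half_dom.
Qed.

Lemma dense_S_dom (w : H) (e : R) : 0 < e -> exists z, rnorm (w - val z) < e.
Proof.
move=> e0; have [[Sd _] _ _ _] := S_sqrt.
have ec : 0 < e%:C by rewrite ltcR.
have [|//|u [wu Su]] := Sd (ball w e%:C).
- by exists w; exact: ballxx.
- exact: ball_open.
exists (insubd 0 u); rewrite val_insubd_half//.
by move: wu; rewrite -ball_normE /= normE ltcR.
Qed.

Lemma dense_S_dom_eq (w w' : H) :
  (forall z, dot w (val z) = dot w' (val z)) -> w = w'.
Proof.
move=> ww'; apply/eqP; rewrite -subr_eq0; apply/eqP/rnorm_eq0/eqP.
rewrite eq_le rnorm_ge0 andbT; apply/ler_addgt0Pr => e e0; rewrite add0r.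
have [w0|w0] := eqVneq (rnorm (w - w')) 0; first by rewrite w0 ltW.
have wp : 0 < rnorm (w - w') by rewrite lt_def w0 rnorm_ge0.
have [z ze] := dense_S_dom (w - w') e0.
rewrite -(ler_pM2l wp) -expr2 (rnorm_sqr norm_dot).
have -> : dot (w - w') (w - w') = dot (w - w') (w - w' - val z).
  rewrite (dotBr dot (w - w') (w - w') (val z)) (dotBl dot w w' (val z)).
  by rewrite ww' subrr subr0.
apply: le_trans (cauchy_schwarz_Re norm_dot _ _) _.
by rewrite ler_wpM2l ?rnorm_ge0// ltW.
Qed.

(** A preimage of [w] under [A0] factors through [S], which gives both the
    surjectivity of [S] and the estimate behind [half_norm_dominates]. *)
Lemma A0_solve : exists2 C : R, 0 <= C & forall w : H, exists x y,
  [/\ pdom A0 (val x), S (val x) = val y, S (val y) = w &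
      rnorm (val x) <= C * rnorm w].
Proof.
have [G [[C GC] GA _]] := A0_resolvent.
have [_ _ Adom AE] := S_sqrt.
exists `|C| => // w; have [Gw] := GA w.
rewrite scale0r subr0 AE// => SSG; move: (Gw); rewrite Adom => -[SG SSGd].
exists (insubd 0 (G w)), (insubd 0 (S (G w))).
rewrite !val_insubd_half//; split => //.
by apply: le_trans (GC w) _; rewrite ler_wpM2r ?rnorm_ge0 ?ler_norm.
Qed.

Lemma half_norm_dominates :
  exists2 K : R, 0 < K & forall z, rnorm (val z) <= K * nhalf z.
Proof.
have [C C0 AC] := A0_solve; exists (Num.sqrt C + 1) => [|z].
  by rewrite ltr_wpDl ?sqrtr_ge0.
have [x [y [_ Sx Sy xC]]] := AC (val z).
(* |z|^2 = <S y, z> = <y, S z>, where |y|^2 = <S y, x> = <z, x> *)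
have y2 : rnorm (val y) ^+ 2 <= C * rnorm (val z) ^+ 2.
  rewrite (rnorm_sqr norm_dot) -{2}Sx -S_symmetric Sy.
  apply: le_trans (cauchy_schwarz_Re norm_dot _ _) _.
  by have := ler_wpM2l (rnorm_ge0 (val z)) xC; lra.
have {}y2 : rnorm (val y) <= Num.sqrt C * rnorm (val z).
  rewrite -(ger0_norm (rnorm_ge0 (val z))) -sqrtr_sqr -sqrtrM//.
  by rewrite -(ger0_norm (rnorm_ge0 (val y))) -sqrtr_sqr ler_wsqrtr.
have [z0|z0] := eqVneq (rnorm (val z)) 0.
  by rewrite z0 mulr_ge0 ?nhalf_ge0// addr_ge0 ?sqrtr_ge0.
have zp : 0 < rnorm (val z) by rewrite lt_def z0 rnorm_ge0.
rewrite -(ler_pM2l zp) -expr2 (rnorm_sqr norm_dot) -{1}Sy S_symmetric.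
apply: le_trans (cauchy_schwarz_Re norm_dot _ _) _.
have := ler_wpM2r (nhalf_ge0 z) y2.
have := mulr_ge0 (rnorm_ge0 (val z)) (nhalf_ge0 z).
by rewrite /nhalf; lra.
Qed.

Lemma nhalf_eq0 z : nhalf z = 0 -> z = 0.
Proof.
have [K _ zK] := half_norm_dominates; move=> z0; apply: val_inj.
apply: rnorm_eq0; apply/eqP; rewrite eq_le rnorm_ge0 andbT.
by apply: le_trans (zK z) _; rewrite z0 mulr0.
Qed.

Lemma S_half_inj x y : S (val x) = S (val y) -> x = y.
Proof.
move=> Sxy; apply/eqP; rewrite -subr_eq0; apply/eqP/nhalf_eq0.
rewrite /nhalf -scaleN1r addrC S_half_linear Sxy scaleN1r addNr rnorm0 //.
Qed.

Lemma S_half_bijective : exists T : H -> Hhalf S,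
  (forall w, S (val (T w)) = w) /\ (forall z, T (S (val z)) = z).
Proof.
have [C _ AC] := A0_solve.
have /choice[T TS] : forall w, exists z, S (val z) = w.
  by move=> w; have [x [y [_ _ Sy _]]] := AC w; exists y.
by exists T; split => // z; apply: S_half_inj.
Qed.

(** On the domain of [A0] this is the symmetry of [S].  That domain is the
    image under the inverse of [S] of the dense domain of [S], hence dense in
    [H_{1/2}], where both sides are continuous in [z]. *)
Lemma A0e_pairing (A0e : {linear Hhalf S -> Hmhalf S}) :
  is_extension dot A0 A0e ->
  forall z v, pairing (A0e z) v = dot (S (val z)) (S (val v)).
Proof.
move=> [A0e_bdd A0eE] z v.
have [C C0 A0eC] := form_bound A0e_bdd.
have [T [ST TS]] := S_half_bijective.
have [_ _ Adom AE] := S_sqrt.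
apply/eqP; rewrite -subr_eq0; apply/eqP/(@rnorm_eq0 _ (R[i]^o))/eqP.
rewrite eq_le rnorm_ge0 andbT; apply/ler_addgt0Pr => e e0; rewrite add0r.
pose M := (C + 1) * nhalf v + 1.
have M0 : 0 < M.
  by rewrite ltr_wpDl// mulr_ge0 ?nhalf_ge0// addr_ge0.
have [y yz] := dense_S_dom (S (val z)) (divr_gt0 e0 M0).
pose x := T (val y).
have Ax : pdom A0 (val x).
  rewrite Adom; split; first exact: val_half_dom.
  by rewrite /x ST; exact: val_half_dom.
have SxE : S (val x) = val y by rewrite /x ST.
have -> : pairing (A0e z) v - dot (S (val z)) (S (val v)) =
    pairing (A0e (z - x)) v + dot (val y - S (val z)) (S (val v)).
  have xv : pairing (A0e x) v = dot (val y) (S (val v)).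
    by rewrite (A0eE x Ax) AE// SxE S_symmetric.
  have -> : A0e (z - x) = -1 *: A0e x + A0e z by rewrite linearB scaleN1r addrC.
  by rewrite pairing_linearl xv dotBl; ring.
apply: le_trans (ler_rnormD _ _) _.
have zx : nhalf (z - x) < e / M.
  by rewrite /nhalf -scaleN1r addrC S_half_linear SxE scaleN1r addrC.
have yz' : rnorm (val y - S (val z)) < e / M by rewrite -rnormN opprB.
apply: le_trans (lerD (A0eC _ _) (cauchy_schwarz norm_dot _ _)) _.
have v0 := nhalf_ge0 v; rewrite -/(nhalf v).
have eM : e / M * M = e by rewrite divfK ?gt_eqF.
have d0 : 0 < e / M by rewrite divr_gt0.
apply: (@le_trans _ _ (C * (e / M * nhalf v) + e / M * nhalf v)).
  apply: lerD; last by rewrite ler_wpM2r// ltW.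
  by rewrite ler_wpM2l// ler_wpM2r// ltW.
rewrite -[leRHS]eM /M; move: (e / M) d0 => d d0; lra.
Qed.

End square_root.

(** * The quadratic pencil and the resolvent set *)

Section pencil.
Variables (R : realType) (H : completeNormedModType R[i]).
Variables (dot : {dot H for (@Num.conj R[i])}).
Hypothesis norm_dot : forall x : H, `|x| ^+ 2 = dot x x.
Variables (A0 S : linop H H).
Hypothesis A0_resolvent : resolvent_set (@rnorm R H) A0 0.
Hypothesis S_sqrt : is_sqrt_op dot S A0.
Variables A0e D : {linear Hhalf S -> Hmhalf S}.
Hypothesis A0e_extension : is_extension dot A0 A0e.
Hypothesis D_bounded : bounded_op (@nhalf R H S) (@nmhalf R H S) D.
Variable l : R[i].
Implicit Types z v : Hhalf S.
Implicit Types x y : energy_space S.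

(** The form of [l^2 + l D + A_0]. *)
Definition pencil z v : R[i] :=
  dot (S (val z)) (S (val v)) + l * pairing (D z) v +
  l ^+ 2 * dot (val z) (val v).

(** The form of [- g - l f - D f], for [y = (f, g)]. *)
Definition load y v : R[i] :=
  - dot (y.2 + l *: val y.1) (val v) - pairing (D y.1) v.

Definition pencil_solution x y : Prop :=
  x.2 = l *: val x.1 + val y.1 /\ forall v, pencil x.1 v = load y v.

Lemma pencilPl a z z' v : pencil (a *: z + z') v = a * pencil z v + pencil z' v.
Proof.
by rewrite /pencil S_half_linear linearP pairing_linearl !dotPl; ring.
Qed.

Lemma pencilPr a z v v' :
  pencil z (a *: v + v') = Num.conj a * pencil z v + pencil z v'.
Proof.
by rewrite /pencil S_half_linear pairing_linearr !dotPr; ring.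
Qed.

Lemma loadPl a y y' v : load (a *: y + y') v = a * load y v + load y' v.
Proof.
rewrite /load /= (linearP D) pairing_linearl.
have -> : a *: y.2 + y'.2 + l *: (a *: val y.1 + val y'.1) =
    a *: (y.2 + l *: val y.1) + (y'.2 + l *: val y'.1).
  by rewrite !scalerDr !scalerA (mulrC l) addrACA.
by rewrite dotPl; ring.
Qed.

Lemma loadPr a y v v' :
  load y (a *: v + v') = Num.conj a * load y v + load y v'.
Proof. by rewrite /load /= pairing_linearr !dotPr; ring. Qed.

Lemma pencil_solution_linear a x x' y y' : pencil_solution x y ->
  pencil_solution x' y' -> pencil_solution (a *: x + x') (a *: y + y').
Proof.
move=> [x2 xE] [x2' xE']; split=> [|v].
  rewrite /= x2 x2' !scalerDr !scalerA (mulrC a l).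
  by rewrite addrACA.
by rewrite pencilPl xE xE' loadPl.
Qed.

(** The membership of [A_0 z + D w] in the pivot space is part of the equation:
    a solution of the weak form exhibits the representing element, which is
    unique by density. *)
Lemma block_solutionP x y :
  (pdom (block_op dot A0e D) x /\ block_op dot A0e D x - l *: x = y) <->
  pencil_solution x y.
Proof.
have key z v (u : H) : z = l *: x.1 + y.1 -> u = val z ->
    (pairing (A0e x.1 + D z) v = dot (- (y.2 + l *: u)) (val v)) <->
    (pencil x.1 v = load y v).
  move=> -> ->.
  have -> : pairing (A0e x.1 + D (l *: x.1 + y.1)) v =
      dot (S (val x.1)) (S (val v)) +
      (l * pairing (D x.1) v + pairing (D y.1) v).
    have -> : A0e x.1 + D (l *: x.1 + y.1) =
        1 *: A0e x.1 + (l *: D x.1 + D y.1) by rewrite linearP scale1r.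
    rewrite !pairing_linearl mul1r.
    by rewrite (A0e_pairing norm_dot A0_resolvent S_sqrt A0e_extension).
  have -> : - (y.2 + l *: val (l *: x.1 + y.1)) =
      (- l ^+ 2) *: val x.1 + ((-1) *: (y.2 + l *: val y.1) + 0).
    rewrite /= scalerDr scalerA -expr2 addr0 scaleN1r scaleNr -opprD.
    by rewrite addrCA.
  rewrite dotPl dotPl (linear0l dot) /pencil /load.
  have move_terms (s d d' p q : R[i]) :
      (s + (l * d + d') = - l ^+ 2 * p + (-1 * q + 0)) <->
      (s + l * d + l ^+ 2 * p = - q - d').
    split=> e.
      have -> : s = - l ^+ 2 * p + (-1 * q + 0) - (l * d + d').
        by rewrite -e addrK.
      by ring.
    have -> : s = - q - d' - (l * d + l ^+ 2 * p) by rewrite -e; ring.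
    by ring.
  exact: move_terms.
split.
  move=> [[Sx2 [h hE]]] xy.
  have x1 : insubd (0 : Hhalf S) x.2 = l *: x.1 + y.1.
    by rewrite -xy /= addrC subrK.
  have x2E : x.2 = val (insubd (0 : Hhalf S) x.2) by rewrite val_insubd_half.
  split=> [|v]; first by rewrite x2E x1.
  apply/(key _ _ x.2 x1 x2E).
  have -> : - (y.2 + l *: x.2) =
      pivot_rep dot (A0e x.1 + D (insubd (0 : Hhalf S) x.2)).
    by rewrite -xy /= subrK opprK.
  by rewrite /pivot_rep; case: xgetP => [u _ /(_ v)//|/(_ h)].
move=> [x2 xE].
have x2v : x.2 = val (l *: x.1 + y.1) by rewrite x2.
have Sx2 : pdom S x.2 by rewrite x2v; exact: val_half_dom.
have x1 : insubd (0 : Hhalf S) x.2 = l *: x.1 + y.1.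
  by apply: val_inj; rewrite val_insubd_half.
have x2E : x.2 = val (insubd (0 : Hhalf S) x.2) by rewrite val_insubd_half.
have rep : represents dot (- (y.2 + l *: x.2))
    (A0e x.1 + D (insubd (0 : Hhalf S) x.2)).
  by move=> v; apply/(key _ _ x.2 x1 x2E).
split; first by split => //; exists (- (y.2 + l *: x.2)).
have repE : pivot_rep dot (A0e x.1 + D (insubd (0 : Hhalf S) x.2)) =
    - (y.2 + l *: x.2).
  apply: (dense_S_dom_eq norm_dot S_sqrt) => v.
  by rewrite -rep /pivot_rep; case: xgetP => [u _ /(_ v)//|/(_ _ rep)].
apply: injective_projections => /=.
  by rewrite x1 addrAC subrr add0r.
by rewrite repE opprK addrK.
Qed.

Section coercive.
Variables (mu : R[i]) (c : R).
Hypothesis c_gt0 : 0 < c.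
Hypothesis pencil_coercive :
  forall z, c * nhalf z ^+ 2 <= complex.Re (mu * pencil z z).

Lemma load_bound : exists2 B : R, 0 <= B &
  forall y v, cabs (load y v) <= B * nenergy y * nhalf v.
Proof.
have [K K0 zK] := half_norm_dominates norm_dot A0_resolvent S_sqrt.
have [C C0 DC] := form_bound D_bounded.
exists ((1 + cabs l * K) * K + C).
  by rewrite addr_ge0// mulr_ge0 ?addr_ge0 ?mulr_ge0 ?rnorm_ge0// ltW.
move=> y v; have [y1 y2] := nenergy_ge y.
have v0 := nhalf_ge0 v; have l0 : 0 <= cabs l by exact: rnorm_ge0.
have n0 : 0 <= nenergy y by exact: sqrtr_ge0.
apply: le_trans (ler_rnormD _ _) _; rewrite !rnormN mulrDl mulrDl.
apply: lerD.
  apply: le_trans (cauchy_schwarz norm_dot _ _) _.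
  have yl : rnorm (y.2 + l *: val y.1) <= (1 + cabs l * K) * nenergy y.
    apply: le_trans (ler_rnormD _ _) _; rewrite rnormZ mulrDl mul1r lerD//.
    rewrite -mulrA ler_wpM2l//; apply: le_trans (zK _) _.
    by rewrite ler_wpM2l// ltW.
  apply: le_trans (ler_pM (rnorm_ge0 _) (rnorm_ge0 _) yl (zK v)) _.
  by rewrite le_eqVlt; apply/orP; left; apply/eqP; ring.
apply: le_trans (DC _ _) _.
by rewrite mulrA ler_wpM2r// ler_wpM2l.
Qed.

(** The Lax-Milgram theorem on [H], transported to [H_{1/2}] by the inverse
    [T] of [S], an isometry from [H] onto [H_{1/2}]. *)
Lemma pencil_solvable y : exists x, pencil_solution x y.
Proof.
have [T [ST TS]] := S_half_bijective norm_dot A0_resolvent S_sqrt.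
have TP a w w' : T (a *: w + w') = a *: T w + T w'.
  apply: (S_half_inj norm_dot A0_resolvent S_sqrt).
  by rewrite S_half_linear !ST.
have T_isometry w : nhalf (T w) = rnorm w by rewrite /nhalf ST.
pose b w w' := pencil (T w) (T w').
have bl w' : GRing.linear_for *%R (b^~ w').
  by move=> a u v; rewrite /b TP pencilPl.
have br w : GRing.linear_for conj_scale (b w).
  by move=> a u v; rewrite /b TP pencilPr.
pose b' := HB.pack_for
  {bilinear H -> H -> R[i] | *%R & conj_scale} b
  (bilinear_isBilinear.Build _ _ _ _ _ _ b (bl, br)).
pose f w := load y (T w).
have fl : GRing.linear_for conj_scale f.
  by move=> a u v; rewrite /f TP loadPr.
pose f' := HB.pack_for {linear H -> R[i] | conj_scale} f
  (GRing.isLinear.Build _ _ _ _ f fl).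
have [K K0 zK] := half_norm_dominates norm_dot A0_resolvent S_sqrt.
have [C C0 DC] := form_bound D_bounded.
have [B B0 yB] := load_bound.
pose Cb := 1 + cabs l * C + cabs l ^+ 2 * (K * K).
have [|w|||w|w bw] :=
    @lax_milgram R H dot norm_dot b' f' mu c Cb (B * nenergy y).
- exact: c_gt0.
- by rewrite -T_isometry; exact: pencil_coercive.
- by rewrite /Cb !addr_ge0 ?mulr_ge0 ?sqr_ge0 ?rnorm_ge0// ltW.
- move=> w w'; rewrite /= /b /pencil -!T_isometry !(mulrDl _ _ (_ * _)) mul1r.
  apply: le_trans (ler_rnormD _ _) _; apply: lerD.
    apply: le_trans (ler_rnormD _ _) _; apply: lerD.
      exact: cauchy_schwarz.
    by rewrite cabsM -mulrA ler_wpM2l ?rnorm_ge0.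
  rewrite cabsM expr2 cabsM -expr2 -mulrA ler_wpM2l ?sqr_ge0//.
  apply: le_trans (cauchy_schwarz norm_dot _ _) _.
  apply: le_trans (ler_pM (rnorm_ge0 _) (rnorm_ge0 _) (zK _) (zK _)) _.
  by rewrite le_eqVlt; apply/orP; left; apply/eqP; ring.
- by rewrite /= /f -T_isometry; exact: yB.
exists (T w, l *: val (T w) + val y.1); split => // v.
by rewrite -(TS v); exact: bw.
Qed.

(** Testing the equation with the first component of the solution gives its
    bound in [H_{1/2}]; the second component is an explicit combination. *)
Lemma pencil_solution_bound : exists B : R, forall x y,
  pencil_solution x y -> nenergy x <= B * nenergy y.
Proof.
have [K K0 zK] := half_norm_dominates norm_dot A0_resolvent S_sqrt.
have [B B0 yB] := load_bound.
pose B1 := cabs mu * B / c.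
have B10 : 0 <= B1 by rewrite divr_ge0 ?mulr_ge0 ?rnorm_ge0// ltW.
have l0 : 0 <= cabs l by exact: rnorm_ge0.
exists (B1 + (cabs l * (K * B1) + K)) => x y [x2 xE].
have [y1 _] := nenergy_ge y.
have n0 : 0 <= nenergy y by exact: sqrtr_ge0.
have x1B : nhalf x.1 <= B1 * nenergy y.
  have [->|z0] := eqVneq (nhalf x.1) 0; first exact: mulr_ge0.
  have zp : 0 < nhalf x.1 by rewrite lt_def z0 nhalf_ge0.
  rewrite /B1 mulrAC ler_pdivlMr// mulrC -(ler_pM2r zp) -mulrA -expr2.
  apply: le_trans (pencil_coercive _) _; apply: le_trans (Re_cabs _) _.
  rewrite cabsM xE -!mulrA ler_wpM2l ?rnorm_ge0//.
  by rewrite mulrA; exact: yB.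
apply: le_trans (nenergy_le x) _; rewrite [leRHS]mulrDl lerD//.
rewrite x2; apply: le_trans (ler_rnormD _ _) _; rewrite rnormZ mulrDl lerD//.
  rewrite -mulrA ler_wpM2l//; apply: le_trans (zK _) _.
  by rewrite -mulrA ler_wpM2l// ltW.
by apply: le_trans (zK _) _; rewrite ler_wpM2l// ltW.
Qed.

(** The a priori bound gives both the uniqueness of solutions, hence the
    linearity of the solution map, and its boundedness. *)
Lemma coercive_resolvent :
  resolvent_set (@nenergy R H S) (block_op dot A0e D) l.
Proof.
have [B xB] := pencil_solution_bound.
have uniq x x' y : pencil_solution x y -> pencil_solution x' y -> x = x'.
  move=> xs xs'.
  have := xB _ _ (pencil_solution_linear (-1) xs' xs).
  have -> : nenergy (-1 *: y + y) = 0.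
    apply/eqP; rewrite eq_le sqrtr_ge0 andbT scaleN1r addNr.
    by apply: le_trans (nenergy_le _) _; rewrite /nhalf S_half0 !rnorm0 addr0.
  rewrite mulr0 scaleN1r addrC => d0.
  have [d1 d2] := nenergy_ge (x - x').
  have e1 : x.1 - x'.1 = 0.
    apply: (nhalf_eq0 norm_dot A0_resolvent S_sqrt).
    by apply/eqP; rewrite eq_le nhalf_ge0 andbT; exact: le_trans d1 d0.
  have e2 : x.2 - x'.2 = 0.
    apply: rnorm_eq0.
    by apply/eqP; rewrite eq_le rnorm_ge0 andbT; exact: le_trans d2 d0.
  by apply: injective_projections; apply/eqP; rewrite -subr_eq0; apply/eqP.
have /choice[G Gs] := pencil_solvable.
have Gl : linear G.
  move=> a y y'; apply: (uniq _ _ (a *: y + y')) => //.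
  exact: pencil_solution_linear.
pose G' := HB.pack_for {linear energy_space S -> energy_space S} G
  (GRing.isLinear.Build _ _ _ _ G Gl).
exists G'; split.
- by exists B => y; exact: xB.
- by move=> y; apply/block_solutionP; exact: Gs.
- move=> x xd; apply: (uniq _ _ _ (Gs _)).
  exact/block_solutionP.
Qed.

End coercive.
End pencil.

(** * The strip and the curve *)

Section real_inequalities.
Variable R : realType.
Implicit Types b d t N p q r : R.

(** [I0] is the set where the parabola [t (b - t)] exceeds [b / d]; dividing
    by [b - t] gives the last inequality. *)
Lemma strip_curve b d t : 0 < b -> 0 < d -> I0 b d t ->
  [/\ 0 < t, t < b & b / d * (t / (b - t)) < t ^+ 2].
Proof.
move=> b0 d0; rewrite /I0; case: ifPn => // bd4.
rewrite -ltNge in bd4; rewrite /= in_itv /=.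
have bd0 : 0 < b * d by exact: mulr_gt0.
set s := Num.sqrt _ => /andP[t1 t2].
have s2 : s ^+ 2 = 1 - 4 / (b * d).
  by rewrite sqr_sqrtr// subr_ge0 ler_pdivrMr// mul1r ltW.
have bd : 0 < b / d by exact: divr_gt0.
have parabola : b / d < t * (b - t).
  have : (b / 2) ^+ 2 * s ^+ 2 = b ^+ 2 / 4 - b / d.
    by rewrite s2; field; rewrite ?gt_eqF.
  have := mulr_gt0 (_ : 0 < t - b / 2 * (1 - s)) (_ : 0 < b / 2 * (1 + s) - t).
  by rewrite !subr_gt0 => /(_ t1 t2); lra.
have t0 : 0 < t.
  have : s < 1.
    rewrite -(@ltr_sqr _ s 1) ?nnegrE ?sqrtr_ge0// s2 expr1n gtrBl divr_gt0//.
  by have : 0 < b / 2 by [lra]; nra.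
have tb : t < b by have := lt_trans bd parabola; rewrite pmulr_rgt0// subr_gt0.
split => //.
have bt : 0 < b - t by rewrite subr_gt0.
by rewrite mulrA ltr_pdivrMr// expr2 -[ltRHS]mulrA [ltLHS]mulrC ltr_pM2l.
Qed.

(** The estimates of [r] are combined with weights [t / b] and [1 - t / b],
    chosen so that the terms in [p] cancel. *)
Lemma curve_coercive b d t N p q r : 0 < b -> 0 < d -> 0 < t -> t < b ->
  0 <= N ->
  b * p <= r -> d * q <= r ->
  (N * (1 - t / b) * d - t) * q <= - t * q + N * r + N * - t * p.
Proof.
move=> b0 d0 t0 tb N0 pr qr.
have th0 : 0 <= t / b by rewrite divr_ge0// ltW.
have th1 : 0 <= 1 - t / b by rewrite subr_ge0 ler_pdivrMr// mul1r ltW.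
have := ler_wpM2l (mulr_ge0 N0 th0) pr.
have := ler_wpM2l (mulr_ge0 N0 th1) qr.
have -> : N * (t / b) * (b * p) = N * t * p by field; rewrite gt_eqF.
lra.
Qed.

Lemma curve_constant_gt0 b d t N : 0 < b -> 0 < d -> t < b ->
  b / d * (t / (b - t)) < N -> 0 < N * (1 - t / b) * d - t.
Proof.
move=> b0 d0 tb; have bt : 0 < b - t by rewrite subr_gt0.
have k0 : 0 < d * (b - t) / b by rewrite divr_gt0// mulr_gt0.
rewrite -(ltr_pM2r k0).
have -> : b / d * (t / (b - t)) * (d * (b - t) / b) = t.
  by field; rewrite !gt_eqF.
have -> : N * (d * (b - t) / b) = N * (1 - t / b) * d by field; rewrite gt_eqF.
by rewrite subr_gt0.
Qed.

End real_inequalities.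

Lemma Re_conj_quadratic (R : rcfType) (l w : R[i]) (p q : R) :
  complex.Re (Num.conj l * (q%:C + l * w + l ^+ 2 * p%:C)) =
  complex.Re l * q + (complex.Re l ^+ 2 + complex.Im l ^+ 2) * complex.Re w +
  (complex.Re l ^+ 2 + complex.Im l ^+ 2) * complex.Re l * p.
Proof.
rewrite expr2 !(ReD, ImD, ReM, ImM) Re_conj Im_conj /=.
move: (complex.Re l) (complex.Im l) (complex.Re w) (complex.Im w) => a b r s.
ring.
Qed.

(** * The constants [beta], [gamma], [delta] *)

Section constants.
Variables (R : realType) (H : completeNormedModType R[i]).
Variables (S : linop H H) (D : Hhalf S -> Hmhalf S).
Hypothesis D_accretive : forall z, 0 <= re_form D z.
Hypothesis nhalf_definite : forall z : Hhalf S, nhalf z = 0 -> z = 0.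
Implicit Types z : Hhalf S.

Lemma rnorm_half_gt0 z : z != 0 -> 0 < rnorm (val z).
Proof.
move=> z0; rewrite lt_def rnorm_ge0 andbT; apply: contra z0 => /eqP z0.
by apply/eqP/val_inj; exact: rnorm_eq0.
Qed.

Lemma nhalf_gt0 z : z != 0 -> 0 < nhalf z.
Proof.
move=> z0; rewrite lt_def nhalf_ge0 andbT; apply: contra z0 => /eqP z0.
by apply/eqP; exact: nhalf_definite.
Qed.

Lemma beta_le z : beta D * rnorm (val z) ^+ 2 <= re_form D z.
Proof.
have [->|z0] := eqVneq z 0.
  by rewrite rnorm0 expr0n mulr0.
rewrite -ler_pdivlMr ?exprn_gt0 ?rnorm_half_gt0//.
apply: ge_inf; last by exists z.
by exists 0 => _ [y _ <-]; rewrite divr_ge0 ?sqr_ge0.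
Qed.

Lemma delta_le z : delta D * nhalf z ^+ 2 <= re_form D z.
Proof.
have [->|z0] := eqVneq z 0.
  by rewrite /nhalf S_half0 rnorm0 expr0n mulr0.
rewrite -ler_pdivlMr ?exprn_gt0 ?nhalf_gt0//.
apply: ge_inf; last by exists z.
by exists 0 => _ [y _ <-]; rewrite divr_ge0 ?sqr_ge0.
Qed.

Lemma gamma_ge z (g : R) : gamma D = g%:E ->
  re_form D z <= g * rnorm (val z) ^+ 2.
Proof.
move=> gE; have [->|z0] := eqVneq z 0.
  by rewrite /re_form pairing0r rnorm0 expr0n mulr0.
rewrite -ler_pdivrMr ?exprn_gt0 ?rnorm_half_gt0// -lee_fin -gE.
by apply: ereal_sup_ubound; exists z.
Qed.

(** On the zero space the infimum is taken over the empty set and is 0. *)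
Lemma delta_gt0_nontrivial : 0 < delta D -> exists z, z != 0.
Proof.
move=> d0; apply: contrapT => /forallNP z0; move: d0.
rewrite /delta (_ : [set _ | _ in _] = set0) ?inf0 ?ltxx//.
by apply/seteqP; split => // _ [z /= zn0 _]; exact: z0 zn0.
Qed.

(** [delta / K^2] is a lower bound of the quotients defining [beta]. *)
Lemma beta_gt0 (K : R) : 0 < K -> (forall z, rnorm (val z) <= K * nhalf z) ->
  0 < delta D -> 0 < beta D.
Proof.
move=> K0 zK d0.
apply: (@lt_le_trans _ _ (delta D / K ^+ 2)).
  by rewrite divr_gt0// exprn_gt0.
apply: lb_le_inf.
  have [z z0] := delta_gt0_nontrivial d0.
  by exists (re_form D z / rnorm (val z) ^+ 2), z.
move=> _ [z /= z0 <-]; rewrite ler_pdivlMr ?exprn_gt0 ?rnorm_half_gt0//.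
apply: le_trans (delta_le z); rewrite mulrAC ler_pdivrMr ?exprn_gt0//.
rewrite -mulrA ler_wpM2l ?(ltW d0)// mulrC -exprMn ler_sqr ?nnegrE ?rnorm_ge0//.
  exact: zK.
by rewrite mulr_ge0 ?nhalf_ge0// ltW.
Qed.

End constants.

(** * Three regimes of coercivity *)

Section spectrum_of_block.
Variables (R : realType) (H : completeNormedModType R[i]).
Variables (dot : {dot H for (@Num.conj R[i])}).
Hypothesis norm_dot : forall x : H, `|x| ^+ 2 = dot x x.
Variables (A0 S : linop H H).
Hypothesis A0_resolvent : resolvent_set (@rnorm R H) A0 0.
Hypothesis S_sqrt : is_sqrt_op dot S A0.
Variables A0e D : {linear Hhalf S -> Hmhalf S}.
Hypothesis A0e_extension : is_extension dot A0 A0e.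
Hypothesis D_bounded : bounded_op (@nhalf R H S) (@nmhalf R H S) D.
Hypothesis D_accretive : forall z, 0 <= re_form D z.
Hypothesis delta_gt0 : 0 < delta D.
Implicit Types z : Hhalf S.
Implicit Types l : R[i].

Let rho := resolvent_set (@nenergy R H S) (block_op dot A0e D).

Let coercive_rho l mu c := @coercive_resolvent R H dot norm_dot A0 S
  A0_resolvent S_sqrt A0e D A0e_extension D_bounded l mu c.

Let d_le z : delta D * nhalf z ^+ 2 <= re_form D z.
Proof. exact: delta_le (nhalf_eq0 norm_dot A0_resolvent S_sqrt) _. Qed.

Lemma block_beta_gt0 : 0 < beta D.
Proof.
have [K K0 zK] := half_norm_dominates norm_dot A0_resolvent S_sqrt.
exact: (beta_gt0 D_accretive (nhalf_eq0 norm_dot A0_resolvent S_sqrt) K0 zK).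
Qed.

Lemma Re_conj_pencil l z :
  complex.Re (Num.conj l * pencil dot D l z z) =
  complex.Re l * nhalf z ^+ 2 +
  (complex.Re l ^+ 2 + complex.Im l ^+ 2) * re_form D z +
  (complex.Re l ^+ 2 + complex.Im l ^+ 2) * complex.Re l * rnorm (val z) ^+ 2.
Proof.
rewrite /pencil -!norm_dot !normE -!rmorphXn -/(nhalf z).
exact: Re_conj_quadratic.
Qed.

(** All terms of [Re_conj_pencil] are nonnegative, and [delta] bounds the one
    in [D]; the multiplier degenerates at [l = 0], where 1 is used instead. *)
Lemma rho_right l : 0 <= complex.Re l -> rho l.
Proof.
move=> l0; have [->|ln0] := eqVneq l 0.
  apply: (@coercive_rho 0 1 1) => // z.
  by rewrite /pencil mul0r expr0n mul0r !addr0 !mul1r -(rnorm_sqr norm_dot).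
pose N := complex.Re l ^+ 2 + complex.Im l ^+ 2.
have N0 : 0 < N.
  rewrite /N -cabs_sqr exprn_gt0// lt_def rnorm_ge0 andbT.
  by apply: contra ln0 => /eqP/(@rnorm_eq0 _ R[i]^o)->.
apply: (@coercive_rho l (Num.conj l) (N * delta D)) => [|z].
  exact: mulr_gt0.
rewrite Re_conj_pencil -/N -mulrA.
have := ler_wpM2l (ltW N0) (d_le z).
have := mulr_ge0 l0 (sqr_ge0 (nhalf z)).
have := mulr_ge0 (mulr_ge0 (ltW N0) l0) (sqr_ge0 (rnorm (val z))).
move: (complex.Re l) (re_form D z) => *; lra.
Qed.

Lemma rho_outside_curve l (t := - complex.Re l) : 0 < t -> t < beta D ->
  beta D / delta D * (t / (beta D - t)) < t ^+ 2 + complex.Im l ^+ 2 -> rho l.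
Proof.
move=> t0 tb curve; have b0 := block_beta_gt0.
pose N := t ^+ 2 + complex.Im l ^+ 2.
have N0 : 0 <= N by rewrite addr_ge0 ?sqr_ge0.
have NE : complex.Re l ^+ 2 + complex.Im l ^+ 2 = N by rewrite /N sqrrN.
have lt : complex.Re l = - t by rewrite opprK.
pose c := N * (1 - t / beta D) * delta D - t.
apply: (@coercive_rho l (Num.conj l) c) => [|z].
  exact: curve_constant_gt0.
rewrite Re_conj_pencil NE lt.
by apply: curve_coercive => //; exact: beta_le.
Qed.

(** The multiplier is [- conj l]: the damping term is then absorbed by the
    term in [rnorm (val z) ^+ 2]. *)
Lemma rho_left l (g : R) : gamma D = g%:E -> complex.Re l < - g -> rho l.
Proof.
move=> gE lg.
have g0 : 0 <= g.
  have [z z0] := delta_gt0_nontrivial delta_gt0.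
  rewrite -(@pmulr_lge0 _ (rnorm (val z) ^+ 2)) ?exprn_gt0 ?rnorm_half_gt0//.
  exact: le_trans (D_accretive z) (gamma_ge z gE).
pose N := complex.Re l ^+ 2 + complex.Im l ^+ 2.
have N0 : 0 <= N by rewrite addr_ge0 ?sqr_ge0.
apply: (@coercive_rho l (- Num.conj l) (- complex.Re l)) => [|z].
  by rewrite oppr_gt0 (lt_le_trans lg)// oppr_le0.
rewrite (mulNr (Num.conj l)) ReN Re_conj_pencil -/N.
have gl : g <= - complex.Re l by rewrite lerNr ltW.
have := ler_wpM2l N0 (le_trans (gamma_ge z gE) (ler_wpM2r (sqr_ge0 _) gl)).
by move: (complex.Re l) (re_form D z) => *; lra.
Qed.

End spectrum_of_block.

Theorem theorem6p1 (R : realType) (H : completeNormedModType R[i])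
  (dot : {dot H for (@Num.conj R[i])})
  (norm_dot : forall x : H, `|x| ^+ 2 = dot x x)
  (A0 : linop H H)
  (A0_self_adjoint : self_adjoint dot A0)
  (A0_positive : uniformly_positive dot A0)
  (A0_resolvent : resolvent_set (@rnorm R H) A0 0)
  (S : linop H H)
  (S_sqrt : is_sqrt_op dot S A0)
  (A0e : {linear Hhalf S -> Hmhalf S})
  (A0e_extension : is_extension dot A0 A0e)
  (D : {linear Hhalf S -> Hmhalf S})
  (D_bounded : bounded_op (@nhalf R H S) (@nmhalf R H S) D)
  (D_accretive : forall z : Hhalf S, 0 <= complex.Re (pairing (D z) z))
  (D_H1 : forall z : Hhalf S, pdom A0 (val z) -> in_pivot dot (D z))
  (delta_gt0 : 0 < delta D) :
  let A := block_op dot A0e D in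
  let sigma := spectrum (@nenergy R H S) A in
  let rho := resolvent_set (@nenergy R H S) A in
  [/\ 0 < beta D,
      sigma `<=` [set l : R[i] |
        [/\ complex.Re l < 0,
            ~ I0 (beta D) (delta D) `|complex.Re l| &
            (`|complex.Im l|%:E <=
              h0 (beta D) (delta D) `|complex.Re l|)%E]],
      4 < beta D * delta D ->
        sigma `&` [set l | I0 (beta D) (delta D) `|complex.Re l|] = set0 &
      (gamma D < +oo)%E ->
        (exists l0 : R[i], rho l0 /\ ((complex.Re l0)%:E < - gamma D)%E) ->
        sigma `&` [set l | ((complex.Re l)%:E < - gamma D)%E] = set0].
Proof.
move=> A sigma rho.
have b0 : 0 < beta D.
  exact: (block_beta_gt0 norm_dot A0_resolvent S_sqrt D_accretive delta_gt0).
have right l : 0 <= complex.Re l -> rho l.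
  exact: (rho_right norm_dot A0_resolvent S_sqrt A0e_extension D_bounded
    D_accretive delta_gt0).
have curve l : 0 < - complex.Re l -> - complex.Re l < beta D ->
    beta D / delta D * (- complex.Re l / (beta D - - complex.Re l)) <
      (- complex.Re l) ^+ 2 + complex.Im l ^+ 2 -> rho l.
  exact: (rho_outside_curve norm_dot A0_resolvent S_sqrt A0e_extension
    D_bounded D_accretive delta_gt0).
have sub : sigma `<=` [set l : R[i] | [/\ complex.Re l < 0,
    ~ I0 (beta D) (delta D) `|complex.Re l| &
    (`|complex.Im l|%:E <= h0 (beta D) (delta D) `|complex.Re l|)%E]].
  move=> l /= sl.
  have l0 : complex.Re l < 0.
    by rewrite ltNge; apply/negP => /right/sl.
  have t0 : 0 < - complex.Re l by rewrite oppr_gt0.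
  rewrite ltr0_norm//; split => //.
    move=> /(strip_curve b0 delta_gt0)[_ tb tc]; apply: sl; apply: curve => //.
    by apply: lt_le_trans tc _; rewrite lerDl sqr_ge0.
  rewrite /h0; case: ifPn => [tb|_]; last exact: leey.
  rewrite lee_fin leNgt; apply/negP => Xl; apply: sl; apply: curve => //.
  rewrite [ltRHS]addrC -ltrBlDr; set X := _ - _ in Xl *.
  have [X0|X0] := leP 0 X; last by rewrite (lt_le_trans X0)// sqr_ge0.
  rewrite -(sqr_sqrtr X0) -[ltRHS]real_normK ?num_real//.
  by rewrite ltr_sqr// nnegrE ?sqrtr_ge0.
split => //.
  move=> _; rewrite -subset0 => l [/sub[_ nI _]].
  exact: nI.
move=> gfin _; rewrite -subset0 => l [sl /= lg].
have [z z0] := delta_gt0_nontrivial delta_gt0.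
have : gamma D \is a fin_num.
  rewrite ge0_fin_numE//.
  apply: (@le_trans _ _ (re_form D z / rnorm (val z) ^+ 2)%:E).
    by rewrite lee_fin divr_ge0 ?sqr_ge0//; exact: D_accretive.
  by apply: ereal_sup_ubound; exists z.
move=> /fineK gE; apply: sl.
apply: (rho_left norm_dot A0_resolvent S_sqrt A0e_extension D_bounded
  D_accretive delta_gt0 (esym gE)).
by move: lg; rewrite -gE -EFinN lte_fin.
Qed.
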